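(* Let $J=\mathbb{N}$ and $J^*=\mathbb{N}\setminus\{1\}$, or $J=J^*=\mathbb{Z}$. Let $(X_k)_{k\in J}$ be Banach spaces, let $T_k\in L(X_k,X_{k-1})$ for $k\in J^*$ with $\sup_{k\in J^*}\|T_k\|<\infty$, and let $1\le p<\infty$. If $B_{(T_k)}$ is frequently hypercyclic on $\ell^p((X_k)_k,J)$, then $B_{(T_k)}$ is mixing on $\ell^p((X_k)_k,J)$.
   Context: $\mathbb{N}=\{1,2,3,\dots\}$; $L(X,Z)$ denotes the bounded linear operators from $X$ to $Z$. $\ell^p((X_k)_k,J)=\{(x_k)_{k}\in\prod_{k\in J} X_k:\sum_k\|x_k\|^p<\infty\}$ with the $\ell^p$-norm. The shift is $B_{(T_k)}(x_k)_{k\in J}=(T_{k+1}x_{k+1})_{k\in J}$; it is a bounded operator because $\sup_k\|T_k\|<\infty$. An operator $S$ on a Banach space $Y$ is mixing if for all non-empty open sets $U,V\subset Y$ the set $\{n\ge 0:S^nU\cap V\neq\emptyset\}$ is cofinite; it is frequently hypercyclic if there exists $y\in Y$ such that for every non-empty open set $U\subset Y$ the set $\{n\ge 0:S^ny\in U\}$ has positive lower density. The lower density of $A\subset\mathbb{N}\cup\{0\}$ is $\liminf_{N\to\infty}\frac{|A\cap[0,N]|}{N+1}$. *)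

(* Defs.v *)
From HB Require Import structures.
From mathcomp Require Import all_boot all_order all_algebra.
From mathcomp Require Import all_classical all_reals all_analysis.
From mathcomp.real_closed Require Import complex.
From mathcomp Require Import ring lra.

Set Implicit Arguments.
Unset Strict Implicit.
Unset Printing Implicit Defensive.

Import Order.TTheory GRing.Theory Num.Theory.
Import numFieldNormedType.Exports.
Local Open Scope classical_set_scope.
Local Open Scope ring_scope.

Variant scalars := RealScalars | ComplexScalars.

Definition scalar_field (R : realType) (s : scalars) : numFieldType :=
  match s with RealScalars => R | ComplexScalars => R[i] end.

Definition scalar_re (R : realType) (s : scalars) : scalar_field R s -> R :=
  match s return scalar_field R s -> R with
  | RealScalars => id
  | ComplexScalars => @complex.Re R
  end.

Definition of_real (R : realType) (s : scalars) : R -> scalar_field R s :=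
  match s return R -> scalar_field R s with
  | RealScalars => id
  | ComplexScalars => real_complex R
  end.

Section scalars_theory.
Variables (R : realType) (s : scalars).
Implicit Types x y : R.

Lemma of_realK x : scalar_re (of_real s x) = x.
Proof. by case: s. Qed.

Lemma scalar_reK (z : scalar_field R s) : 0 <= z -> of_real s (scalar_re z) = z.
Proof. by case: s z => //= z z0; rewrite RRe_real // ger0_real. Qed.

Lemma ler_of_real x y : (of_real s x <= of_real s y) = (x <= y).
Proof. by case: s => //=; rewrite lecR. Qed.

Lemma ltr_of_real x y : (of_real s x < of_real s y) = (x < y).
Proof. by case: s => //=; rewrite ltcR. Qed.

Lemma of_real0 : of_real s 0 = 0 :> scalar_field R s.
Proof. by case: s. Qed.

Lemma of_realD x y : of_real s (x + y) = of_real s x + of_real s y.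
Proof. by case: s => //=; rewrite rmorphD. Qed.

Lemma of_realM x y : of_real s (x * y) = of_real s x * of_real s y.
Proof. by case: s => //=; rewrite rmorphM. Qed.

Lemma of_real_inj : injective (@of_real R s).
Proof. exact: can_inj of_realK. Qed.

End scalars_theory.

(* The library's norm on a normed module over [K] takes its values in [K];
   [rnorm] is the same norm, read as a real number. *)
Definition rnorm (R : realType) (s : scalars)
    (V : normedModType (scalar_field R s)) (x : V) : R := scalar_re `|x|.

Section rnorm.
Variables (R : realType) (s : scalars) (V : normedModType (scalar_field R s)).
Implicit Types x y : V.

Lemma of_real_rnorm x : of_real s (rnorm x) = `|x|.
Proof. exact: scalar_reK. Qed.

Lemma rnorm_ge0 x : 0 <= rnorm x.
Proof. by rewrite -(ler_of_real s) of_real0 of_real_rnorm. Qed.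

Lemma rnormD x y : rnorm (x + y) <= rnorm x + rnorm y.
Proof. by rewrite -(ler_of_real s) of_realD !of_real_rnorm ler_normD. Qed.

Lemma rnormZ a x : rnorm (a *: x) = scalar_re `|a| * rnorm x.
Proof.
by apply: (@of_real_inj _ s); rewrite of_realM !of_real_rnorm scalar_reK// normrZ.
Qed.

Lemma rnorm0 : rnorm (0 : V) = 0.
Proof. by apply: (@of_real_inj _ s); rewrite of_real_rnorm of_real0 normr0. Qed.

Lemma rnorm0_eq0 x : rnorm x = 0 -> x = 0.
Proof. by move=> x0; apply: normr0_eq0; rewrite -of_real_rnorm x0 of_real0. Qed.

Lemma rnormN x : rnorm (- x) = rnorm x.
Proof. by rewrite /rnorm normrN. Qed.

End rnorm.

Definition opnorm (R : realType) (s : scalars)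
    (V W : normedModType (scalar_field R s)) (T : V -> W) : \bar R :=
  ereal_sup [set (rnorm (T x))%:E | x in [set x : V | rnorm x <= 1]].

Lemma rnorm_opnorm (R : realType) (s : scalars)
    (V W : normedModType (scalar_field R s)) (T : {linear V -> W}) (M : R) :
  (opnorm T <= M%:E)%E -> forall x, rnorm (T x) <= M * rnorm x.
Proof.
move=> TM x; have [x0|x0] := eqVneq (rnorm x) 0.
  by rewrite (rnorm0_eq0 x0) linear0 !rnorm0 mulr0.
have x_gt0 : 0 < rnorm x by rewrite lt_neqAle eq_sym x0 rnorm_ge0.
have reV : scalar_re `|of_real s (rnorm x)^-1| = (rnorm x)^-1.
  rewrite ger0_norm ?of_realK// -of_real0 ler_of_real invr_ge0.
  exact: rnorm_ge0.
have : (rnorm (T (of_real s (rnorm x)^-1 *: x)) <= M).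
  rewrite -lee_fin; apply: le_trans TM; apply: ereal_sup_ubound.
  by eexists; last reflexivity; rewrite /= rnormZ reV mulVf.
by rewrite linearZ/= rnormZ reV mulrC ler_pdivrMr.
Qed.

Section lp_sum.
Variables (R : realType) (J : choiceType) (p : R).
Hypothesis p1 : 1 <= p.
Implicit Types f g : J -> R.

Let p_gt0 : 0 < p. Proof. exact: lt_le_trans p1. Qed.
Let p_ge0 : 0 <= p. Proof. exact: ltW. Qed.

Definition lp_sum f : \bar R := (\esum_(k in [set: J]) (f k `^ p)%:E)%E.

Lemma lp_sum_ge0 f : (0 <= lp_sum f)%E.
Proof. by apply: esum_ge0 => k _; rewrite lee_fin powR_ge0. Qed.

Lemma le_lp_sum f g : (forall k, 0 <= f k <= g k) -> (lp_sum f <= lp_sum g)%E.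
Proof.
move=> fg; apply: le_esum => k _; rewrite lee_fin.
have /andP[f0 fgk] := fg k.
by rewrite ge0_ler_powR// ?nnegrE// (le_trans f0).
Qed.

Lemma lp_sumZ (c : R) f : 0 <= c -> (forall k, 0 <= f k) ->
  lp_sum (fun k => c * f k) = ((c `^ p)%:E * lp_sum f)%E.
Proof.
move=> c0 f0; have p_neq0 : p != 0 by rewrite gt_eqF.
have E k : ((c * f k) `^ p)%:E = ((c `^ p)%:E * (f k `^ p)%:E)%E.
  by rewrite powRM ?f0// EFinM.
rewrite /lp_sum /esum -ereal_supZl ?powR_ge0//; last first.
  by apply/set0P; eexists; exists set0; [exact: fsets_set0 | reflexivity].
congr ereal_sup; rewrite image_comp; apply: eq_imagel => A _ /=.
rewrite ge0_mule_fsumr => [|k]; last by rewrite lee_fin powR_ge0.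
by apply: eq_fsbigr => k _; rewrite E.
Qed.

Lemma lp_minkowski f g a b : (forall k, 0 <= f k) -> (forall k, 0 <= g k) ->
  0 < a -> 0 < b -> (lp_sum f <= (a `^ p)%:E)%E -> (lp_sum g <= (b `^ p)%:E)%E ->
  (lp_sum (fun k => (f k + g k)%R) <= ((a + b) `^ p)%:E)%E.
Proof.
move=> f0 g0 a0 b0 fa gb.
have ab0 : 0 < a + b by rewrite addr_gt0.
pose u := (a + b) `^ p * (a / (a + b) / a `^ p).
pose v := (a + b) `^ p * (b / (a + b) / b `^ p).
have u0 : 0 <= u by rewrite !mulr_ge0 ?invr_ge0 ?powR_ge0 ?ltW.
have v0 : 0 <= v by rewrite !mulr_ge0 ?invr_ge0 ?powR_ge0 ?ltW.
have key k : (f k + g k) `^ p <= u * f k `^ p + v * g k `^ p.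
  have -> : f k + g k =
      (a + b) * (a / (a + b) * (f k / a) + b / (a + b) * (g k / b)).
    by field; rewrite !gt_eqF.
  have fa0 : 0 <= f k / a by rewrite divr_ge0// ltW.
  have gb0 : 0 <= g k / b by rewrite divr_ge0// ltW.
  have t0 : 0 <= a / (a + b) by rewrite divr_ge0 ?ltW.
  have t1 : a / (a + b) <= 1 by rewrite ler_pdivrMr// mul1r lerDl ltW.
  have t0' : 0 <= b / (a + b) by rewrite divr_ge0 ?ltW.
  rewrite powRM ?(ltW ab0)//; last by apply: addr_ge0; apply: mulr_ge0.
  rewrite /u /v -!mulrA -mulrDr ler_wpM2l ?powR_ge0//.
  have : (a / (a + b) * (f k / a) + (1 - a / (a + b)) * (g k / b)) `^ p <=
      a / (a + b) * (f k / a) `^ p + (1 - a / (a + b)) * (g k / b) `^ p.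
    by apply: (@convex_powR _ p p1 (Itv01 t0 t1));
      rewrite !inE/= !in_itv/= !andbT.
  have -> : 1 - a / (a + b) = b / (a + b) by field; rewrite gt_eqF.
  have E x y : 0 <= x -> 0 < y -> (x / y) `^ p = (y `^ p)^-1 * x `^ p.
    move=> x0 y0; rewrite powRM ?invr_ge0 ?(ltW y0)// mulrC; congr (_ * _).
    by rewrite -!powRN -powR_inv1 ?(ltW y0)// -powRrM mulN1r.
  by rewrite [(f k / a) `^ p]E// [(g k / b) `^ p]E// !mulrA.
have uv : u * a `^ p + v * b `^ p = (a + b) `^ p.
  have ap : a `^ p != 0 by rewrite gt_eqF// powR_gt0.
  have bp : b `^ p != 0 by rewrite gt_eqF// powR_gt0.
  by rewrite /u /v; field; rewrite ap bp gt_eqF.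
clearbody u v.
apply: (@le_trans _ _ (u%:E * lp_sum f + v%:E * lp_sum g)%E); last first.
  rewrite -uv EFinD !EFinM.
  by apply: leeD; apply: lee_wpmul2l.
have [u' u'0 up] : exists2 u', 0 <= u' & u = u' `^ p.
  exists (u `^ p^-1); first exact: powR_ge0.
  by rewrite -powRrM mulVf ?gt_eqF// powRr1.
have [v' v'0 vp] : exists2 v', 0 <= v' & v = v' `^ p.
  exists (v `^ p^-1); first exact: powR_ge0.
  by rewrite -powRrM mulVf ?gt_eqF// powRr1.
rewrite up vp -(lp_sumZ u'0 f0) -(lp_sumZ v'0 g0) /lp_sum -esumD; last 2 first.
- by move=> k _; rewrite lee_fin powR_ge0.
- by move=> k _; rewrite lee_fin powR_ge0.
apply: le_esum => k _; rewrite -EFinD lee_fin.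
by rewrite (powRM _ u'0 (f0 k)) (powRM _ v'0 (g0 k)) -up -vp.
Qed.

Lemma lp_sum_ge f k : (forall k, 0 <= f k) -> ((f k `^ p)%:E <= lp_sum f)%E.
Proof.
move=> f0; apply: esum_ge; exists [set k]; last by rewrite fsbig_set1.
by split=> //; exact: finite_set1.
Qed.

Lemma lp_sum_restrict f (A : set J) : finite_set A ->
  lp_sum (fun k => if k \in A then f k else 0) =
  (\sum_(k \in A) (f k `^ p)%:E)%E.
Proof.
move=> finA; rewrite -esum_fset//; last first.
  by move=> k _; rewrite lee_fin powR_ge0.
rewrite esum_mkcond; apply: eq_esum => k _.
by case: ifP => // _; rewrite powR0// gt_eqF.
Qed.

End lp_sum.

(* The condition [1 <= p] is a parameter because the norm below is a norm only
   then. *)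
Record lp (R : realType) (s : scalars) (J : choiceType) (p : R) (p1 : 1 <= p)
    (X : J -> completeNormedModType (scalar_field R s)) := Lp {
  lp_val :> forall k, X k ;
  lp_summable : (lp_sum p (fun k => rnorm (lp_val k)) < +oo)%E }.

Section lp_lmodule.
Variables (R : realType) (s : scalars) (J : choiceType) (p : R) (p1 : 1 <= p).
Variable X : J -> completeNormedModType (scalar_field R s).
Local Notation lp := (lp p1 X).
Implicit Types x y z : lp.

Let p_gt0 : 0 < p. Proof. exact: lt_le_trans p1. Qed.
Let p_ge0 : 0 <= p. Proof. exact: ltW. Qed.

HB.instance Definition _ := gen_eqMixin lp.
HB.instance Definition _ := gen_choiceMixin lp.

Lemma lp_eqP x y : (forall k, x k = y k) -> x = y.
Proof.
case: x y => [x xP] [y yP] /= xy.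
have {xy} xy : x = y by exact: functional_extensionality_dep.
by subst y; congr Lp; exact: Prop_irrelevance.
Qed.

Definition lp_norm x : R := fine (lp_sum p (fun k => rnorm (x k))) `^ p^-1.

Lemma lp_norm_ge0 x : 0 <= lp_norm x. Proof. exact: powR_ge0. Qed.

Lemma lp_normX x : (lp_norm x `^ p)%:E = lp_sum p (fun k => rnorm (x k)).
Proof.
rewrite -powRrM mulVf ?gt_eqF// powRr1 ?fine_ge0 ?lp_sum_ge0//.
by rewrite fineK// ge0_fin_numE ?lp_sum_ge0// lp_summable.
Qed.

Lemma lp_norm_le x a : 0 <= a ->
  (lp_norm x <= a) = (lp_sum p (fun k => rnorm (x k)) <= (a `^ p)%:E)%E.
Proof.
move=> a0; rewrite -lp_normX lee_fin; apply/idP/idP => [xa|].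
  by rewrite ge0_ler_powR// nnegrE ?lp_norm_ge0.
apply: contraTT; rewrite -!ltNge => ax.
by rewrite gt0_ltr_powR// nnegrE ?lp_norm_ge0.
Qed.

Lemma rnorm_lp_norm x k : rnorm (x k) <= lp_norm x.
Proof.
have : ((rnorm (x k) `^ p)%:E <= (lp_norm x `^ p)%:E)%E.
  by rewrite lp_normX; apply: lp_sum_ge => // j; exact: rnorm_ge0.
rewrite lee_fin; apply: contraTT; rewrite -!ltNge => xk.
by rewrite gt0_ltr_powR// nnegrE ?lp_norm_ge0 ?rnorm_ge0.
Qed.

Let lp_sumD x y a b : lp_norm x < a -> lp_norm y < b ->
  (lp_sum p (fun k => rnorm (x k + y k)%R) <= ((a + b) `^ p)%:E)%E.
Proof.
move=> xa yb.
have a0 : 0 < a by rewrite (le_lt_trans _ xa)// lp_norm_ge0.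
have b0 : 0 < b by rewrite (le_lt_trans _ yb)// lp_norm_ge0.
apply: (@le_trans _ _ (lp_sum p (fun k => (rnorm (x k) + rnorm (y k))%R))).
  by apply: le_lp_sum => // k; rewrite rnorm_ge0 rnormD.
apply: lp_minkowski => // [k|k||]; rewrite ?rnorm_ge0//.
  by rewrite -lp_norm_le ltW.
by rewrite -lp_norm_le ltW.
Qed.

Let lp_sum_scale (c : scalar_field R s) x :
  lp_sum p (fun k => rnorm (c *: x k)%R) =
  ((scalar_re `|c| `^ p)%:E * lp_sum p (fun k => rnorm (x k)))%E.
Proof.
have c0 : 0 <= scalar_re `|c| by rewrite -(ler_of_real s) of_real0 scalar_reK.
rewrite -lp_sumZ//; last by move=> k; exact: rnorm_ge0.
by congr lp_sum; apply/funext => k; rewrite rnormZ.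
Qed.

Let lp_zero_summable : (lp_sum p (fun k => rnorm (0%R : X k)) < +oo)%E.
Proof.
rewrite /lp_sum esum1 ?ltry// => k _.
by rewrite rnorm0 powR0// gt_eqF.
Qed.

Let lp_opp_summable x : (lp_sum p (fun k => rnorm (- x k)%R) < +oo)%E.
Proof.
have -> : (fun k => rnorm (- x k)) = (fun k => rnorm (x k)).
  by apply/funext => k; rewrite rnormN.
exact: lp_summable.
Qed.

Let lp_add_summable x y : (lp_sum p (fun k => rnorm (x k + y k)%R) < +oo)%E.
Proof.
by apply: (le_lt_trans (@lp_sumD x y (lp_norm x + 1) (lp_norm y + 1) _ _));
  rewrite ?ltrDl ?ltry.
Qed.

Let lp_scale_summable c x : (lp_sum p (fun k => rnorm (c *: x k)%R) < +oo)%E.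
Proof. by rewrite lp_sum_scale -lp_normX -EFinM ltry. Qed.

Definition lp_zero : lp := Lp p1 lp_zero_summable.
Definition lp_opp x : lp := Lp p1 (lp_opp_summable x).
Definition lp_add x y : lp := Lp p1 (lp_add_summable x y).
Definition lp_scale c x : lp := Lp p1 (lp_scale_summable c x).

Let lp_addA : associative lp_add.
Proof. by move=> x y z; apply: lp_eqP => k /=; rewrite addrA. Qed.
Let lp_addC : commutative lp_add.
Proof. by move=> x y; apply: lp_eqP => k /=; rewrite addrC. Qed.
Let lp_add0 : left_id lp_zero lp_add.
Proof. by move=> x; apply: lp_eqP => k /=; rewrite add0r. Qed.
Let lp_addN : left_inverse lp_zero lp_opp lp_add.
Proof. by move=> x; apply: lp_eqP => k /=; rewrite addNr. Qed.

HB.instance Definition _ :=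
  GRing.isZmodule.Build lp lp_addA lp_addC lp_add0 lp_addN.

Let lp_scaleA a b x : lp_scale a (lp_scale b x) = lp_scale (a * b) x.
Proof. by apply: lp_eqP => k /=; rewrite scalerA. Qed.
Let lp_scale1 : left_id 1 lp_scale.
Proof. by move=> x; apply: lp_eqP => k /=; rewrite scale1r. Qed.
Let lp_scaleDr : right_distributive lp_scale +%R.
Proof. by move=> a x y; apply: lp_eqP => k /=; rewrite scalerDr. Qed.
Let lp_scaleDl x : {morph lp_scale^~ x : a b / a + b}.
Proof. by move=> a b; apply: lp_eqP => k /=; rewrite scalerDl. Qed.

HB.instance Definition _ := GRing.Zmodule_isLmodule.Build (scalar_field R s) lp
  lp_scaleA lp_scale1 lp_scaleDr lp_scaleDl.

Let lp_normD x y :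
  of_real s (lp_norm (x + y)) <= of_real s (lp_norm x) + of_real s (lp_norm y).
Proof.
rewrite -of_realD ler_of_real; apply/ler_addgt0Pr => e e0.
have e2 : 0 < e / 2 by rewrite divr_gt0.
rewrite (_ : _ + e = (lp_norm x + e / 2) + (lp_norm y + e / 2)); last first.
  by rewrite addrACA -splitr.
rewrite lp_norm_le; last by rewrite !addr_ge0 ?lp_norm_ge0// ltW.
by apply: lp_sumD; rewrite ltrDl.
Qed.

Let lp_normZ (c : scalar_field R s) x :
  of_real s (lp_norm (c *: x)) = `|c| * of_real s (lp_norm x).
Proof.
have c0 : 0 <= scalar_re `|c| by rewrite -(ler_of_real s) of_real0 scalar_reK.
rewrite -[`|c| in RHS]scalar_reK// -of_realM; congr of_real.
rewrite /lp_norm lp_sum_scale fineM//; last by rewrite -lp_normX.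
rewrite powRM ?powR_ge0 ?fine_ge0 ?lp_sum_ge0//=.
by rewrite -powRrM mulfV ?gt_eqF// powRr1.
Qed.

Let lp_norm0_eq0 x : of_real s (lp_norm x) = 0 -> x = 0.
Proof.
rewrite -(of_real0 R s) => /of_real_inj x0; apply: lp_eqP => k.
apply: rnorm0_eq0; apply/eqP; rewrite eq_le rnorm_ge0 andbT -x0.
exact: rnorm_lp_norm.
Qed.

HB.instance Definition _ := Lmodule_isNormed.Build (scalar_field R s) lp
  lp_normD lp_normZ lp_norm0_eq0.

Lemma rnorm_lpE x : rnorm x = lp_norm x.
Proof. exact: of_realK. Qed.

End lp_lmodule.

Lemma three_quarters_le (R : realFieldType) (r : R) :
  0 < r -> r / 4 + r / 4 + r / 4 <= r.
Proof. by move=> r0; lra. Qed.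

Section lp_complete.
Variables (R : realType) (s : scalars) (J : choiceType) (p : R) (p1 : 1 <= p).
Variable X : J -> completeNormedModType (scalar_field R s).
Local Notation lp := (lp p1 X).

Let p_gt0 : 0 < p. Proof. exact: lt_le_trans p1. Qed.
Let p_ge0 : 0 <= p. Proof. exact: ltW. Qed.

Let lt_rnorm (V : normedModType (scalar_field R s)) (v : V) (e : R) :
  (`|v| < of_real s e) = (rnorm v < e).
Proof. by rewrite -of_real_rnorm ltr_of_real. Qed.

Let small_const (A : set J) (e : R) : finite_set A -> 0 < e ->
  exists2 d : R, 0 < d &
    (lp_sum p (fun k => if k \in A then d else 0%R) <= (e `^ p)%:E)%E.
Proof.
move=> finA e0; pose S := \sum_(k \in A) (1 : R).
have S0 : 0 <= S by apply: fsumr_ge0.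
have S1 : 0 < S + 1 by rewrite ltr_wpDl.
have SE : lp_sum p (fun k => if k \in A then 1 else 0) = S%:E.
  rewrite (@lp_sum_restrict R J p p1 (fun=> 1) A)// -fsumEFin//.
  by apply: eq_fsbigr => k _; rewrite powR1.
have d0 : 0 < e / (S + 1) `^ p^-1 by rewrite divr_gt0// powR_gt0.
exists (e / (S + 1) `^ p^-1) => //.
have -> : (fun k => if k \in A then e / (S + 1) `^ p^-1 else 0) =
    (fun k => e / (S + 1) `^ p^-1 * (if k \in A then 1 else 0)).
  by apply/funext => k; case: ifP => _; rewrite ?mulr1 ?mulr0.
rewrite lp_sumZ//; [|exact: ltW|by move=> k; case: ifP].
rewrite SE -EFinM lee_fin powRM ?invr_ge0 ?powR_ge0//; last exact: ltW.
have -> : ((S + 1) `^ p^-1)^-1 `^ p = (S + 1)^-1.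
  by rewrite -powRN -powRrM mulNr mulVf ?gt_eqF// powR_inv1// ltW.
by rewrite -mulrA ler_piMr ?powR_ge0// mulrC ler_pdivrMr// mul1r lerDl.
Qed.

Let filter_finite (T : Type) (F : set_system T) (FF : Filter F) (A : set J)
    (P : J -> T -> Prop) : finite_set A ->
  (forall k, F [set z | P k z]) -> F [set z | forall k, k \in A -> P k z].
Proof.
move=> /finite_seqP[l ->] PF; elim: l => [|j l ih].
  by apply: nearW => z k; rewrite inE.
apply: filterS2 (PF j) ih => z /= Pj Pl k; rewrite !inE /= inE => /orP[/eqP->//|kl].
by apply: Pl; rewrite inE.
Qed.

Let lp_complete (F : set_system lp) : ProperFilter F -> cauchy F -> cvg F.
Proof.
move=> FF /cauchyP Fc.
have Fball (e : R) : 0 < e -> exists x, F [set z | rnorm (x - z) < e].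
  move=> e0; have [|x xF] := Fc (of_real s e).
    by rewrite -(of_real0 R s) ltr_of_real.
  by exists x; apply: filterS xF => z; rewrite -ball_normE /= lt_rnorm.
have Fk k : cvg ((fun x : lp => x k) @ F).
  apply/cauchy_cvgP/cauchy_exP => e e0.
  have e0' : 0 < scalar_re e.
    by rewrite -(ltr_of_real s) of_real0 scalar_reK// ltW.
  have [x xF] := Fball _ e0'; exists (x k).
  suff : F [set z : lp | ball (x k) e (z k)] by [].
  apply: filterS xF => z /= xz.
  rewrite -ball_normE /= -[e]scalar_reK ?(ltW e0)// lt_rnorm.
  by apply: le_lt_trans xz; rewrite rnorm_lpE; exact: (rnorm_lp_norm (x - z)).
pose y k : X k := lim ((fun x : lp => x k) @ F).
have yF k (d : R) : 0 < d -> F [set z : lp | rnorm (z k - y k) < d].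
  move=> d0; have /cvgr_dist_lt := Fk k => /(_ (of_real s d)).
  rewrite -(of_real0 R s) ltr_of_real => /(_ d0).
  move=> zF; suff : F [set z : lp | `|y k - z k| < of_real s d].
    by apply: filterS => z /=; rewrite distrC lt_rnorm.
  exact: zF.
have key (e : R) x : 0 < e -> F [set z | rnorm (x - z) < e] ->
    (lp_sum p (fun k => rnorm (x k - y k)%R) <= ((e + e) `^ p)%:E)%E.
  move=> e0 xF; apply: ge_ereal_sup => _ [A [finA _] <-].
  rewrite -(@lp_sum_restrict _ _ _ p1)//.
  have [d d0 dA] := small_const finA e0.
  have [z []] : exists z, rnorm (x - z) < e /\
      forall k, k \in A -> rnorm (z k - y k) < d.
    apply: (@filter_ex _ F); apply: filterI => //.
    by apply: filter_finite => // k; exact: yF.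
  rewrite rnorm_lpE => xz zy.
  apply: le_trans (lp_minkowski p1 (f := fun k => rnorm (x k - z k)) _ _ e0 e0 _ dA).
  - apply: le_lp_sum => // k; case: ifP => kA; last by rewrite lexx addr0 rnorm_ge0.
    rewrite rnorm_ge0/= -[x k - y k](subrKA (z k)).
    by apply: le_trans (rnormD _ _) _; rewrite lerD2l ltW// zy.
  - by move=> k; exact: rnorm_ge0.
  - by move=> k; case: ifP => // _; exact: ltW.
  - by rewrite -(lp_norm_le (x - z)) ltW.
have [x1 x1F] := Fball 1 ltr01.
pose w : lp := Lp p1 (le_lt_trans (key 1 x1 ltr01 x1F) (ltry _)).
pose y' : lp := x1 - w.
have y'E k : y' k = y k by rewrite /= opprB addrCA subrr addr0.
apply/cvg_ex; exists y'; apply/cvgrPdist_lt => e e0.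
have e0' : 0 < scalar_re e.
  by rewrite -(ltr_of_real s) of_real0 scalar_reK// ltW.
have e4 : 0 < scalar_re e / 4 by rewrite divr_gt0.
have [x xF] := Fball _ e4.
have xy : rnorm (x - y') <= scalar_re e / 4 + scalar_re e / 4.
  rewrite rnorm_lpE lp_norm_le ?addr_ge0 ?(ltW e4)//.
  apply: le_trans (key _ _ e4 xF); apply: le_lp_sum => // k.
  by rewrite rnorm_ge0 -y'E lexx.
suff : F [set z : lp | `|y' - z| < e] by [].
apply: filterS xF => z /= xz.
rewrite -[e]scalar_reK ?(ltW e0)// lt_rnorm -[y' - z](subrKA x).
apply: le_lt_trans (rnormD _ _) _; rewrite -[y' - x]opprB rnormN.
apply: lt_le_trans (ler_ltD xy xz) _.
exact: three_quarters_le.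
Qed.

HB.instance Definition _ := Uniform_isComplete.Build lp lp_complete.

End lp_complete.

Variant index_set := PositiveIntegers | Integers.

(* The positive integer [k.+1] is represented by [k : nat], hence the index set
   {1, 2, 3, ...} by the type [nat]. *)
Definition idx (J : index_set) : choiceType :=
  match J with PositiveIntegers => nat | Integers => int end.

Definition idx_succ (J : index_set) : idx J -> idx J :=
  match J return idx J -> idx J with
  | PositiveIntegers => fun k : nat => k.+1
  | Integers => fun k : int => k + 1
  end.

Lemma idx_succ_inj J : injective (@idx_succ J).
Proof. by case: J => /= k l; [case | exact: addIr]. Qed.

Section shift.
Variables (R : realType) (s : scalars) (J : index_set) (p : R) (p1 : 1 <= p).
Variable X : idx J -> completeNormedModType (scalar_field R s).
(* [T k] goes from the space of index [k + 1] to that of index [k]: it is the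
   operator usually numbered [k + 1]. *)
Variable T : forall k, {linear X (idx_succ k) -> X k}.
Hypothesis supT : (ereal_sup (range (fun k => opnorm (T k))) < +oo)%E.
Local Notation lp := (lp p1 X).

Let T_bounded : exists2 M : R, 0 <= M &
  forall k x, rnorm (T k x) <= M * rnorm x.
Proof.
have [M TM] : exists M : R, (ereal_sup (range (fun k => opnorm (T k))) <= M%:E)%E.
  case: ereal_sup supT => [r| |] // _; first by exists r.
  by exists 0; rewrite leNye.
exists (Num.max M 0); first by rewrite le_max lexx orbT.
move=> k x; apply: rnorm_opnorm; apply: (@le_trans _ _ M%:E).
  by apply: le_trans TM; apply: ereal_sup_ubound; exists k.
by rewrite lee_fin le_max lexx.
Qed.

Let lp_sum_shift (x : lp) (M : R) : 0 <= M ->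
  (forall k z, rnorm (T k z) <= M * rnorm z) ->
  (lp_sum p (fun k => rnorm (T k (x (idx_succ k)))) <= ((M * lp_norm x) `^ p)%:E)%E.
Proof.
move=> M0 TM.
have p0 : 0 <= p by rewrite (le_trans _ p1).
apply: (@le_trans _ _ (lp_sum p (fun k => M * rnorm (x (idx_succ k))))).
  by apply: le_lp_sum => // k; rewrite rnorm_ge0 TM.
rewrite lp_sumZ//; last by move=> k; exact: rnorm_ge0.
rewrite powRM ?lp_norm_ge0// EFinM; apply: lee_wpmul2l.
  by rewrite lee_fin powR_ge0.
rewrite lp_normX /lp_sum -(esum_image _ _ (fun k => (rnorm (x k) `^ p)%:E)).
  apply: ge_ereal_sup => _ [A [finA _] <-]; apply: esum_ge.
  by exists A => //; split.
by move=> k l _ _; exact: idx_succ_inj.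
Qed.

Let shift_summable (x : lp) :
  (lp_sum p (fun k => rnorm (T k (x (idx_succ k)))) < +oo)%E.
Proof.
have [M M0 TM] := T_bounded.
exact: le_lt_trans (lp_sum_shift x M0 TM) (ltry _).
Qed.

Definition operator_shift (x : lp) : lp := Lp p1 (shift_summable x).

Let shift_is_linear : linear operator_shift.
Proof. by move=> a x y; apply: lp_eqP => k /=; rewrite linearP. Qed.

HB.instance Definition _ :=
  GRing.isLinear.Build (scalar_field R s) lp lp *:%R operator_shift shift_is_linear.

Lemma operator_shift_continuous : continuous operator_shift.
Proof.
have [M M0 TM] := T_bounded.
apply: (@bounded_linear_continuous _ lp lp operator_shift).
apply/linear_boundedP.
exists (of_real s M); split.
  by rewrite realE -(of_real0 R s) ler_of_real M0.
move=> r Mr x.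
apply: (@le_trans _ _ (of_real s M * `|x|)); last first.
  by rewrite ler_wpM2r// ltW.
rewrite -!of_real_rnorm -of_realM ler_of_real !rnorm_lpE lp_norm_le.
  exact: lp_sum_shift.
by rewrite mulr_ge0// lp_norm_ge0.
Qed.

End shift.

Arguments operator_shift {R s J p} p1 {X T} supT x.

Definition mixing (Y : topologicalType) (S : Y -> Y) : Prop :=
  forall U V : set Y, open U -> U !=set0 -> open V -> V !=set0 ->
    cofinite_set [set n : nat | (iter n S @` U) `&` V !=set0].

Definition lower_density (R : realType) (A : set nat) : \bar R :=
  limn_einf (fun N => (#|[pred n : 'I_N.+1 | `[< A n >]]|%:R / N.+1%:R)%:E).

Definition frequently_hypercyclic (R : realType) (Y : topologicalType)
    (S : Y -> Y) : Prop :=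
  exists y : Y, forall U : set Y, open U -> U !=set0 ->
    (0 < lower_density R [set n : nat | U (iter n S y)])%E.

(* Main.v *)
(* Write B for the shift, y for a frequently hypercyclic vector, and pi_S for
   the restriction of a sequence to a set S of indices, so that
   B^d pi_S = pi_(S') B^d with S' the preimage of S under k |-> k + d.
   Mixing follows once, for every vector z with a single nonzero coordinate, at
   index k, and for every e > 0 and all large d,
   (a) some u with |u| < e supported at index k + d has B^d u close to z, and
   (b) some u close to z supported at index k has |B^d u| < e.
   Let A be the set of return times of y to a ball around z. If m and m + d are
   in A and (a) fails for d, then the coordinate of index k + d of B^m y is at
   least e in norm; since B^m y stays in a ball of l^p, this happens for boundedly
   many d. Similarly for (b), with the coordinate of index k - d of B^(m + d) y.
   Hence few differences of elements of A are exceptional. On the other hand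
   |B| <= M makes the exceptions propagate: if d is exceptional for e then d + i
   (in case (a)) or d - i (in case (b)) is exceptional for e / M^i. If there were
   infinitely many exceptions, one could thus find arbitrarily many shifts whose
   differences are all exceptional; the corresponding translates of A would be
   almost disjoint, which contradicts the positive density of A. *)

Require Import Defs.
From HB Require Import structures.
From mathcomp Require Import all_boot all_order all_algebra.
From mathcomp Require Import all_classical all_reals all_analysis.
From mathcomp Require Import zify lra.

Set Implicit Arguments.
Unset Strict Implicit.
Unset Printing Implicit Defensive.

Import Order.TTheory GRing.Theory Num.Theory.
Import numFieldNormedType.Exports.
Local Open Scope classical_set_scope.
Local Open Scope ring_scope.

(** * Differences of sets of positive density *)

Section combinatorics.
Local Open Scope nat_scope.

(** Truncated inclusion-exclusion: a set added to a union loses at most [c] elements to each set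
    already there. *)
Lemma sum_size_le_inclusion_exclusion (T : eqType) (c : nat) (F : nat -> seq T)
    (l : seq nat) :
  (forall i, uniq (F i)) -> pairwise (fun i j => count [in F j] (F i) <= c) l ->
  \sum_(i <- l) size (F i) <=
  size (undup (flatten (map F l))) + size l ^ 2 * c.
Proof.
move=> uF; elim: l => [|i l IH] /=; first by rewrite big_nil.
move=> /andP[il /IH {}IH].
rewrite big_cons undup_cat size_cat (undup_id (uF i)) size_filter.
have il' : count [in flatten (map F l)] (F i) <= size l * c.
  elim: l il {IH} => [|j l IH] /=.
    by move=> _; rewrite (eq_count (a2 := pred0)) ?count_pred0.
  move=> /andP[ij /IH {}IH]; rewrite mulSn.
  apply: leq_trans (leq_add ij IH); rewrite -count_predUI.
  apply: leq_trans (leq_addr _ _); apply: sub_count => x.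
  by rewrite /= mem_cat.
have := count_predC [in flatten (map F l)] (F i).
have -> : count (predC [in flatten (map F l)]) (F i) =
    count (fun x => x \notin flatten (map F l)) (F i) by exact: eq_count.
nia.
Qed.

Definition trunc (A : pred nat) N : seq nat := [seq n <- iota 0 N.+1 | A n].

Definition pair_count (A : pred nat) N d : nat :=
  count (fun m => m + d \in trunc A N) (trunc A N).

Section trunc.
Variable A : pred nat.

Lemma mem_trunc N n : (n \in trunc A N) = A n && (n <= N).
Proof. by rewrite mem_filter mem_iota add0n ltnS. Qed.

Lemma trunc_uniq N : uniq (trunc A N).
Proof. by rewrite filter_uniq// iota_uniq. Qed.

Lemma size_trunc N : size (trunc A N) <= N.+1.
Proof. by rewrite size_filter (leq_trans (count_size _ _))// size_iota. Qed.

(** Double counting: the pairs (m, m + d) are grouped by their smaller member, which takes at most N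
    + 1 values. *)
Lemma sum_pair_count_le_fwd Q N (l : seq nat) :
  (forall m, A m -> count (fun d => A (m + d)) l <= Q) ->
  \sum_(d <- l) pair_count A N d <= Q * N.+1.
Proof.
move=> AQ; rewrite /pair_count.
under eq_bigr do rewrite -sum1_count big_mkcond.
rewrite exchange_big /=.
apply: (@leq_trans (\sum_(m <- trunc A N) Q)); last first.
  by rewrite big_const_seq count_predT iter_addn_0 leq_mul2l size_trunc orbT.
rewrite big_seq [leqRHS]big_seq; apply: leq_sum => m.
rewrite mem_trunc => /andP[/AQ mQ _]; apply: leq_trans mQ.
rewrite -sum1_count [leqRHS]big_mkcond; apply: leq_sum => d _.
by rewrite mem_trunc; case: (A _) => //=; case: ifP.
Qed.

(** The same pairs grouped by their larger member, as case (b) requires: there the bound comes from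
    the orbit at the later time. *)
Lemma sum_pair_count_le_bwd Q N (l : seq nat) :
  (forall n, A n -> count (fun d => (d <= n) && A (n - d)) l <= Q) ->
  \sum_(d <- l) pair_count A N d <= Q * N.+1.
Proof.
move=> AQ.
apply: (@leq_trans
  (\sum_(d <- l) count (fun n => (d <= n) && A (n - d)) (trunc A N))).
  apply: leq_sum => d _; rewrite /pair_count -!size_filter.
  rewrite -(size_map (addn^~ d)); apply: uniq_leq_size.
    by rewrite map_inj_uniq; [exact/filter_uniq/trunc_uniq | exact: addIn].
  move=> _ /mapP[m + ->]; rewrite mem_filter !mem_trunc.
  move=> /andP[/andP[Amd mdN] /andP[Am _]].
  by rewrite mem_filter mem_trunc leq_addl addnK Am Amd.
under eq_bigr do rewrite -sum1_count big_mkcond.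
rewrite exchange_big /=.
apply: (@leq_trans (\sum_(m <- trunc A N) Q)); last first.
  by rewrite big_const_seq count_predT iter_addn_0 leq_mul2l size_trunc orbT.
rewrite big_seq [leqRHS]big_seq; apply: leq_sum => m.
rewrite mem_trunc => /andP[/AQ mQ _]; apply: leq_trans mQ.
by rewrite -sum1_count [leqRHS]big_mkcond.
Qed.

Lemma shift_overlap N x y : y <= x ->
  count [in map (addn y) (trunc A N)] (map (addn x) (trunc A N)) =
  pair_count A N (x - y).
Proof.
move=> yx; rewrite count_map; apply: eq_count => m /=.
by rewrite (_ : x + m = y + (m + (x - y))) ?mem_map //; [exact: addnI|lia].
Qed.

(** The translates all lie in [0, N + P], so their union has at most N + 1 + P elements. *)
Lemma size_trunc_le_shifts N P c (l : seq nat) :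
  all (geq P) l ->
  pairwise (fun x y => (y <= x) && (pair_count A N (x - y) <= c)) l ->
  size l * size (trunc A N) <= N.+1 + P + size l ^ 2 * c.
Proof.
move=> lP lc.
pose F d := map (addn d) (trunc A N).
have -> : size l * size (trunc A N) = \sum_(d <- l) size (F d).
  under eq_bigr do rewrite size_map.
  by rewrite big_const_seq count_predT iter_addn_0 mulnC.
apply: leq_trans (sum_size_le_inclusion_exclusion (c := c) _ _) _.
- by move=> d; rewrite map_inj_uniq ?trunc_uniq//; exact: addnI.
- by apply: sub_pairwise lc => x y /andP[yx]; rewrite shift_overlap.
rewrite leq_add2r -[leqRHS](size_iota 0); apply: uniq_leq_size.
  exact: undup_uniq.
move=> t; rewrite mem_undup => /flattenP[_ /mapP[d /(allP lP)/= dP ->]].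
move=> /mapP[m]; rewrite mem_trunc => /andP[_ mN] ->.
have : d + m \in iota 0 (N.+1 + P) by rewrite mem_iota; lia.
by [].
Qed.

(* [E] models the exceptional differences. The shift [s] accounts for the two
   directions in which exceptions propagate: the window around [e] is [e, e + P]
   for [s = P] and [e - P, e] for [s = 0]. *)
Section sparse.
Variable E : nat -> Prop.
Hypothesis sparse : forall P, exists s Q, forall N (l : seq nat), uniq l ->
  (forall d, d \in l -> exists e, [/\ E e, d <= e + s & e + s <= d + P]) ->
  \sum_(d <- l) pair_count A N d <= Q * N.+1.

(* [P] must not depend on [N], but [l] may: at each step the new largest element
   is picked, depending on [N], from a fixed list of candidates that is longer
   than the number of bad ones. The candidates are more than [P] apart, so that
   distinct bad ones yield distinct differences. *)
Lemma exists_small_overlaps c h : (forall b, exists2 e, E e & b < e) ->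
  exists P, forall N, exists l : seq nat, [/\ size l = h, all (geq P) l &
    pairwise (fun x y => (y <= x) && (c * pair_count A N (x - y) <= N.+1)) l].
Proof.
move=> Eoo; elim: h => [|h [P IH]]; first by exists 0 => N; exists [::].
have [s [Q sQ]] := sparse P.
(* More candidates than can be bad: each bad one yields its own difference with [c * pair_count]
   above N + 1, while the [pair_count] of these differences sum to at most Q * (N + 1). *)
pose K := c * Q + 1.
have [es [esz esE esP es_sep]] : exists es : seq nat, [/\ size es = K,
    forall e, e \in es -> E e, forall e, e \in es -> P < e &
    pairwise (fun x y => y + P < x) es].
  elim: K => [|K [es [esz esE esP es_sep]]]; first by exists [::].
  (* This puts [e] more than [P] above every earlier candidate. *)
  have [e Ee elarge] := Eoo (P + \sum_(x <- es) x).
  exists (e :: es); split=> [|x|x|] /=.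
  - by rewrite esz.
  - by rewrite inE => /predU1P[->|/esE].
  - by rewrite inE => /predU1P[->|/esP//]; lia.
  - rewrite es_sep andbT; apply/allP => x xes.
    by move: elarge; rewrite (big_rem x)//=; lia.
(* The new bound covers [e + s] for every candidate [e], whichever is picked for [N]. *)
exists (\sum_(e <- es) e + s) => N; have [l [lh lP lc]] := IH N.
have [e ees elc] : exists2 e, e \in es &
    all (fun y => c * pair_count A N (e + s - y) <= N.+1) l.
  apply/hasP; apply: contraT; rewrite -all_predC => /allP bad.
  (* The difference between [e + s] and the first element of [l] with which the overlap is too
     large. *)
  pose f e := e + s - nth 0 l (find
    (fun y => ~~ (c * pair_count A N (e + s - y) <= N.+1)) l).
  have fP e : e \in es ->
      [/\ f e <= e + s, e + s <= f e + P & N.+1 < c * pair_count A N (f e)].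
    move=> /[dup] ees /bad /=; rewrite -has_predC => hs.
    have hs' := hs; rewrite has_find in hs'.
    have /allP/(_ _ (mem_nth 0 hs'))/= yP := lP.
    have := nth_find 0 hs; rewrite /= -ltnNge => cy.
    by have := esP _ ees; split; rewrite // /f; set y := nth 0 l _ in yP *; lia.
  have : \sum_(d <- map f es) pair_count A N d <= Q * N.+1.
    apply: sQ.
    (* [f] is injective on the candidates: f e = f x would give e <= x + P. *)
    - move: es_sep fP; clear => es_sep fP; elim: es es_sep fP => //= e es IH.
      move=> /andP[/allP ees /IH {}IH] fP; rewrite IH ?andbT; last first.
        by move=> x xes; apply: fP; rewrite inE xes orbT.
      apply/mapP => -[x xes fex]; have := ees _ xes.
      have [+ _ _] := fP e (mem_head _ _); rewrite fex.
      have [|_ + _] := fP x; first by rewrite inE xes orbT.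
      have [|+ _ _] := fP x; first by rewrite inE xes orbT.
      have [_ + _] := fP e (mem_head _ _); rewrite fex.
      lia.
    - move=> _ /mapP[e ees ->]; exists e; have [? ? _] := fP e ees.
      by split=> //; exact: esE.
  rewrite big_map => sumQ.
  have : K * N.+1 <= c * \sum_(e <- es) pair_count A N (f e).
    rewrite big_distrr /= -esz mulnC -iter_addn_0 -(count_predT es).
    rewrite -big_const_seq /= big_seq [leqRHS]big_seq.
    by apply: leq_sum => e /fP[_ _]; exact: ltnW.
  rewrite /K; nia.
exists (e + s :: l); have ePl := esP _ ees.
have e_le : e <= \sum_(e <- es) e by rewrite (big_rem e)//= leq_addr.
split=> /=; first by rewrite lh.
- by rewrite leq_add2r e_le; apply: sub_all lP => x /=; lia.
- rewrite lc andbT; apply/allP => y yl; rewrite (allP elc)// andbT.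
  by have /allP/(_ _ yl)/= := lP; lia.
Qed.

(** For suitable N > P, the h = 4q translates have total size at least 4(N + 1); but they lie in
    [0, N + P] and their overlaps cost at most N + 1, which leaves less than 3(N + 1). *)
Lemma sparse_bounded q :
  (forall b, exists2 N, b < N & N.+1 <= q * size (trunc A N)) ->
  ~ forall b, exists2 e, E e & b < e.
Proof.
move=> dens Eoo; have q0 : 0 < q by case: q dens => // /(_ 0)[].
pose h := 4 * q; have [P PE] := exists_small_overlaps (h ^ 2) h Eoo.
have [N PN qN] := dens P; have [l [lh lP lc]] := PE N.
have h2 : 0 < h ^ 2 by rewrite expn_gt0 /h; lia.
have lc' : pairwise (fun x y => (y <= x) &&
    (pair_count A N (x - y) <= N.+1 %/ h ^ 2)) l.
  by apply: sub_pairwise lc => x y; rewrite leq_divRL// mulnC.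
have := size_trunc_le_shifts lP lc'; rewrite lh.
have := leq_divM N.+1 (h ^ 2).
rewrite /h; nia.
Qed.

End sparse.
End trunc.
End combinatorics.

(** * Norms and transitions between vectors *)

(** The lower limit is the supremum of the tail infima, so some tail infimum is a positive c; any
    integer q >= 1/c then works. *)
Lemma lower_density_gt0_trunc (R : realType) (A : set nat) :
  (0 < lower_density R A)%E ->
  exists q, forall b, exists2 N, (b < N)%N &
    (N.+1 <= q * size (trunc (fun n => `[< A n >]) N))%N.
Proof.
rewrite /lower_density limn_einf_lim (cvg_lim _ (@cvg_einfs_sup _ _))//.
move=> /ereal_sup_gt[_ [n _ <-]]; set u := (u in einfs u) => u0.
have un k : (n <= k)%N -> (einfs u n <= u k)%E.
  by move=> nk; apply: ereal_inf_lbound; exists k.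
case: (einfs u n) u0 un => [c| |] c0 // un; last by have := un n (leqnn n).
have {}c0 : 0 < c by rewrite -lte_fin.
have [q qc] : exists q : nat, c^-1 <= q%:R.
  exists (Num.bound c^-1); apply/ltW/archi_boundP.
  by rewrite invr_ge0 ltW.
exists q => b; exists (maxn n b.+1); first by rewrite leq_maxr.
set N := maxn n b.+1; have := un N (leq_maxl _ _); rewrite /u lee_fin.
have -> : size (trunc (fun n => `[< A n >]) N) =
    #|[pred n : 'I_N.+1 | `[< A n >]]|.
  rewrite /trunc -val_enum_ord filter_map size_map cardE; congr size.
  by rewrite [RHS]/enum_mem enumT; apply: eq_filter.
rewrite ler_pdivlMr ?ltr0n// => cN.
rewrite -(ler_nat R) natrM; set t := #|_|%:R in cN *.
apply: (@le_trans _ _ (c^-1 * t)); first by rewrite ler_pdivlMl.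
by rewrite ler_wpM2r.
Qed.

Lemma exists_natr_mul_bound (R : realType) (a b : R) : 0 < b ->
  exists Q, forall n, n%:R * b <= a -> (n <= Q)%N.
Proof.
move=> b0; exists (Num.bound (a / b)) => n nba.
have ab : n%:R <= a / b by rewrite ler_pdivlMr.
rewrite -(ler_nat R) (le_trans ab)// ltW// archi_boundP//.
by rewrite (le_trans _ ab).
Qed.

Lemma ler_div_expr (R : realType) (e M : R) i j :
  0 <= e -> 1 <= M -> (i <= j)%N -> e / M ^+ j <= e / M ^+ i.
Proof.
move=> e0 M1 ij; have M0 : 0 < M by exact: lt_le_trans M1.
by rewrite ler_wpM2l// lef_pV2 ?posrE ?exprn_gt0// ler_weXn2l.
Qed.

Lemma continuous_linear_rnorm (R : realType) (s : scalars)
    (V W : normedModType (scalar_field R s)) (f : {linear V -> W}) :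
  continuous f -> exists2 M, 1 <= M & forall x, rnorm (f x) <= M * rnorm x.
Proof.
move=> /(_ 0)/(@continuous_linear_bounded _ _ _ 0)/linear_boundedP.
move=> /pinfty_ex_gt0[M M0 fM].
(* The bound is raised to at least 1 so that its powers are nondecreasing. *)
exists (Num.max (scalar_re M) 1); first by rewrite le_max lexx orbT.
move=> x; rewrite -(ler_of_real s) of_realM !of_real_rnorm.
rewrite (le_trans (fM x))// ler_wpM2r//.
by rewrite -{1}(scalar_reK (ltW M0)) ler_of_real le_max lexx.
Qed.

Lemma rnorm_near_le (R : realType) (s : scalars)
    (V : normedModType (scalar_field R s)) (x z : V) (r : R) :
  rnorm (x - z) < r -> rnorm x <= rnorm z + r.
Proof.
move=> /ltW xz; rewrite -[x](subrK z) addrC.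
by rewrite (le_trans (rnormD _ _))// lerD2l.
Qed.

Lemma open_rnorm_ball (R : realType) (s : scalars)
    (V : normedModType (scalar_field R s)) (U : set V) (x : V) :
  open U -> U x -> exists2 r, 0 < r & forall z, rnorm (z - x) < r -> U z.
Proof.
move=> oU Ux; have /nbhs_ballP[e /= e0 eU] := open_nbhs_nbhs (conj oU Ux).
have e0' : 0 < scalar_re e.
  by rewrite -(ltr_of_real s) of_real0 scalar_reK// ltW.
exists (scalar_re e) => // z zx; apply: eU; rewrite -ball_normE /=.
by rewrite -[e]scalar_reK ?(ltW e0)// distrC -of_real_rnorm ltr_of_real.
Qed.

Lemma rnorm_ball_open (R : realType) (s : scalars)
    (V : normedModType (scalar_field R s)) (x : V) (r : R) :
  open [set z | rnorm (z - x) < r].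
Proof.
have -> : [set z | rnorm (z - x) < r] = ball x (of_real s r).
  rewrite -ball_normE; apply/seteqP.
  by split => z /=; rewrite distrC -of_real_rnorm ltr_of_real.
exact: ball_open.
Qed.

Section reaches.
Variables (R : realType) (s : scalars) (V : normedModType (scalar_field R s)).
Variable f : {linear V -> V}.
Implicit Types (x v : V).

Lemma iter_linearD n x v : iter n f (x + v) = iter n f x + iter n f v.
Proof. by elim: n => //= n ->; rewrite linearD. Qed.

Lemma iter_linear0 n : iter n f 0 = 0.
Proof. by elim: n => //= n ->; rewrite linear0. Qed.

(** Unlike a condition on open sets, this relation is visibly stable under sums and limits of pairs,
    which reduces mixing to vectors with one nonzero coordinate. *)
Definition reaches x v :=
  forall e : R, 0 < e -> exists n0, forall n, (n0 <= n)%N -> exists z,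
    rnorm (z - x) < e /\ rnorm (iter n f z - v) < e.

Lemma rnorm_split (e : R) x x' v v' :
  rnorm (x - v) < e / 2 -> rnorm (x' - v') < e / 2 ->
  rnorm (x + x' - (v + v')) < e.
Proof.
move=> xv xv'; rewrite opprD addrACA.
by rewrite (le_lt_trans (rnormD _ _))// [ltRHS]splitr ltrD.
Qed.

Lemma reachesD x x' v v' :
  reaches x v -> reaches x' v' -> reaches (x + x') (v + v').
Proof.
move=> r r' e e0; have e2 : 0 < e / 2 by rewrite divr_gt0.
have [n0 n0P] := r _ e2; have [m0 m0P] := r' _ e2.
exists (maxn n0 m0) => n; rewrite geq_max => /andP[].
move=> /n0P[z [zx zv]] /m0P[z' [zx' zv']].
exists (z + z'); rewrite iter_linearD.
by split; exact: rnorm_split.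
Qed.

Lemma reaches0 : reaches 0 0.
Proof.
move=> e e0; exists 0%N => n _; exists 0.
by rewrite iter_linear0 subrr rnorm0.
Qed.

Lemma reaches_closed x v :
  (forall e, 0 < e -> exists x' v',
    [/\ rnorm (x - x') < e, rnorm (v - v') < e & reaches x' v']) ->
  reaches x v.
Proof.
move=> xv e e0; have e2 : 0 < e / 2 by rewrite divr_gt0.
have [x' [v' [xx' vv' xv']]] := xv _ e2; have [n0 n0P] := xv' _ e2.
exists n0 => n /n0P[z [zx zv]]; exists z; split.
  rewrite -(subrKA x') (le_lt_trans (rnormD _ _))// [ltRHS]splitr ltrD//.
  by rewrite -rnormN opprB.
rewrite -(subrKA v') (le_lt_trans (rnormD _ _))// [ltRHS]splitr ltrD//.
by rewrite -rnormN opprB.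
Qed.

Lemma reaches_mixing : (forall x v, reaches x v) -> mixing f.
Proof.
move=> rf U W oU [x Ux] oW [v Wv].
have [r r0 rU] := open_rnorm_ball oU Ux; have [t t0 tW] := open_rnorm_ball oW Wv.
have rt0 : 0 < Num.min r t by rewrite lt_min r0.
have [n0 n0P] := rf x v _ rt0.
apply: (@sub_finite_set _ _ `I_n0); last exact: finite_II.
move=> n /= nUW; rewrite ltnNge; apply/negP => /n0P[z [zx zv]]; apply: nUW.
exists (iter n f z); split.
  by exists z => //; apply: rU; rewrite (lt_le_trans zx)// ge_min lexx.
by apply: tW; rewrite (lt_le_trans zv)// ge_min lexx orbT.
Qed.

End reaches.

(** * Restriction of sequences to sets of indices *)

Section lp_mask.
Variables (R : realType) (s : scalars) (J : choiceType) (p : R) (p1 : 1 <= p).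
Variable X : J -> completeNormedModType (scalar_field R s).
Local Notation lp := (lp p1 X).
Implicit Types (x y : lp) (S : set J).

Let p_gt0 : 0 < p. Proof. exact: lt_le_trans p1. Qed.
Let p_ge0 : 0 <= p. Proof. exact: ltW. Qed.

Let ler_powp (a b : R) : 0 <= a -> a <= b -> a `^ p <= b `^ p.
Proof.
by move=> a0 ab; apply: ge0_ler_powR => //; rewrite nnegrE// (le_trans a0).
Qed.

Let lp_mask_summable S x :
  (lp_sum p (fun k => rnorm (if k \in S then x k else 0)%R) < +oo)%E.
Proof.
apply: le_lt_trans (lp_summable x); apply: le_lp_sum => // k.
by rewrite rnorm_ge0 /=; case: ifP; rewrite ?rnorm0 ?rnorm_ge0.
Qed.

Definition lp_mask S x : lp := Lp p1 (lp_mask_summable S x).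

Lemma lp_maskB S x y : lp_mask S (x - y) = lp_mask S x - lp_mask S y.
Proof. by apply: lp_eqP => k /=; case: ifP; rewrite ?subr0. Qed.

Lemma lp_mask_id S x : lp_mask S (lp_mask S x) = lp_mask S x.
Proof. by apply: lp_eqP => k /=; case: (k \in S). Qed.

Lemma lp_mask0 x : lp_mask set0 x = 0.
Proof. by apply: lp_eqP => k /=; rewrite in_set0. Qed.

Lemma lp_maskU S S' x : S `&` S' = set0 ->
  lp_mask (S `|` S') x = lp_mask S x + lp_mask S' x.
Proof.
move=> SS'; apply: lp_eqP => k /=; rewrite in_setU.
have : k \notin S `&` S' by rewrite SS' in_set0.
rewrite in_setI; case: (k \in S) => [/= /negPf ->|_]; first by rewrite addr0.
by rewrite /= add0r.
Qed.

Lemma rnorm_lpX x : (rnorm x `^ p)%:E = lp_sum p (fun k => rnorm (x k)).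
Proof. by rewrite rnorm_lpE lp_normX. Qed.

Lemma rnorm_lp_maskU S S' x : S `&` S' = set0 ->
  rnorm (lp_mask (S `|` S') x) `^ p =
  rnorm (lp_mask S x) `^ p + rnorm (lp_mask S' x) `^ p.
Proof.
move=> SS'; pose f S k := rnorm (lp_mask S x k).
have fE : (lp_sum p (f (S `|` S')) = lp_sum p (f S) + lp_sum p (f S'))%E.
  rewrite /lp_sum -esumD.
  - apply: eq_esum => k _; rewrite /f /= in_setU -EFinD; congr EFin.
    have : k \notin S `&` S' by rewrite SS' in_set0.
    rewrite in_setI; case: (k \in S) => [/= /negPf ->|_].
      by rewrite rnorm0 powR0 ?gt_eqF// addr0.
    by rewrite /= rnorm0 powR0 ?gt_eqF// add0r.
  - by move=> k _; rewrite lee_fin powR_ge0.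
  - by move=> k _; rewrite lee_fin powR_ge0.
have EFinD_inj (a b c : R) (u v w : \bar R) : a%:E = u -> b%:E = v ->
    c%:E = w -> (u = v + w)%E -> a = b + c.
  by move=> <- <- <-; exact: EFin_inj.
exact: (EFinD_inj _ _ _ _ _ _ (rnorm_lpX _) (rnorm_lpX _) (rnorm_lpX _) fE).
Qed.

Lemma rnorm_lp_mask S x : rnorm (lp_mask S x) <= rnorm x.
Proof.
rewrite !rnorm_lpE lp_norm_le ?lp_norm_ge0// lp_normX.
apply: le_lp_sum => // k.
by rewrite rnorm_ge0 /=; case: ifP; rewrite ?rnorm0 ?rnorm_ge0.
Qed.

Lemma sum_rnorm_lp_mask (S : nat -> set J) (l : seq nat) x :
  trivIset setT S -> uniq l ->
  \sum_(d <- l) rnorm (lp_mask (S d) x) `^ p <= rnorm x `^ p.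
Proof.
move=> tS ul.
suff -> : \sum_(d <- l) rnorm (lp_mask (S d) x) `^ p =
    rnorm (lp_mask (\big[setU/set0]_(d <- l) S d) x) `^ p.
  by apply: ler_powp; [exact: rnorm_ge0 | exact: rnorm_lp_mask].
elim: l ul => [|d l IH] /=.
  by rewrite !big_nil lp_mask0 rnorm0 powR0 ?gt_eqF.
move=> /andP[dl /IH {}IH]; rewrite !big_cons IH; apply/esym/rnorm_lp_maskU.
rewrite -bigcup_seq setI_bigcupr bigcup0// => j /= jl.
have /trivIsetP := tS; apply=> //.
by apply: contraNneq dl => ->.
Qed.

(** A Chebyshev-type count of the disjoint blocks on which a vector is large; it is what makes
    exceptional differences rare. *)
Lemma size_large_lp_mask (S : nat -> set J) (l : seq nat) x (e C : R) :
  trivIset setT S -> uniq l -> 0 <= e ->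
  (forall d, d \in l -> e <= rnorm (lp_mask (S d) x)) -> rnorm x <= C ->
  (size l)%:R * e `^ p <= C `^ p.
Proof.
move=> tS ul e0 le xC.
apply: (@le_trans _ _ (rnorm x `^ p)); last first.
  by apply: ler_powp => //; exact: rnorm_ge0.
apply: le_trans (sum_rnorm_lp_mask x tS ul).
rewrite mulr_natl -iter_addr_0 -(count_predT l) -big_const_seq big_seq.
rewrite [leRHS]big_seq; apply: ler_sum => d /le ed.
exact: ler_powp.
Qed.

Lemma lp_mask_finite_approx x (e : R) : 0 < e ->
  exists2 F, finite_set F & rnorm (x - lp_mask F x) < e.
Proof.
have contra (a b c d : R) : a - d < b -> a = b + c -> d <= c -> False by lra.
move=> e0.
have Fc F : x - lp_mask F x = lp_mask (~` F) x.
  apply/eqP; rewrite subr_eq addrC -lp_maskU ?setICr//; apply/eqP.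
  by apply: lp_eqP => k /=; rewrite setUv in_setT.
have ep : 0 < e `^ p by rewrite powR_gt0.
have : ((rnorm x `^ p - e `^ p)%:E <
    lp_sum p (fun k => rnorm (x k)))%E.
  by rewrite -lp_normX -rnorm_lpE lte_fin ltrBlDr ltrDl.
rewrite /lp_sum => /ereal_sup_gt[_ [F [finF _] <-]].
rewrite -(@lp_sum_restrict _ _ _ p1)//.
have -> : lp_sum p (fun k => if k \in F then rnorm (x k) else 0) =
    (rnorm (lp_mask F x) `^ p)%:E.
  rewrite rnorm_lpE lp_normX; congr lp_sum; apply/funext => k /=.
  by case: ifP; rewrite ?rnorm0.
rewrite lte_fin => xF; exists F => //; rewrite Fc.
have := rnorm_lp_maskU x (setICr F); rewrite setUv.
have -> : lp_mask setT x = x by apply: lp_eqP => k /=; rewrite in_setT.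
move=> xE; rewrite ltNge; apply/negP => eF.
apply: contra xF xE _; apply: ler_powp => //; exact: ltW.
Qed.

Lemma lp_mask_finite_ind (P : lp -> Prop) F x : P 0 ->
  (forall x y, P x -> P y -> P (x + y)) ->
  (forall k, P (lp_mask [set k] x)) -> finite_set F -> P (lp_mask F x).
Proof.
move=> P0 PD P1 /finite_seqP[l ->]; elim: l => [|k l IH].
  by rewrite set_nil lp_mask0.
have -> : [set` k :: l] = [set k] `|` [set` l].
  by apply/seteqP; split=> j /=; rewrite inE => /predU1P.
have [kl|kl] := boolP (k \in l).
  by have /setUidPr -> : [set k] `<=` [set` l] by move=> _ ->.
rewrite lp_maskU; first exact: PD.
by apply/seteqP; split=> // j [/= ->]; rewrite (negPf kl).
Qed.

End lp_mask.

(** * The shift *)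

Section shift.
Variables (R : realType) (s : scalars) (J : index_set).
Variable X : idx J -> completeNormedModType (scalar_field R s).
Variable T : forall k, {linear X (idx_succ k) -> X k}.
Hypothesis supT : (ereal_sup (range (fun k => opnorm (T k))) < +oo)%E.
Variables (p : R) (p1 : 1 <= p).
Local Notation lp := (lp p1 X).
Local Notation B := (operator_shift p1 supT).
Local Notation succ := (@idx_succ J).
Implicit Types (x y z v : lp).

Lemma shift_mask S x : B (lp_mask S x) = lp_mask (succ @^-1` S) (B x).
Proof.
apply: lp_eqP => k /=; have -> : (k \in succ @^-1` S) = (succ k \in S).
  by apply/idP/idP; rewrite !inE.
by case: ifP => // _; rewrite linear0.
Qed.

Lemma iter_shift_mask n S x :
  iter n B (lp_mask S x) = lp_mask (iter n succ @^-1` S) (iter n B x).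
Proof.
elim: n S => [|n IH] S //=; rewrite IH shift_mask; congr (lp_mask _ _).
by apply/funext => k; rewrite /preimage /mkset -iterSr.
Qed.

Lemma rnorm_iter_shift : exists2 M, 1 <= M &
  forall n x, rnorm (iter n B x) <= M ^+ n * rnorm x.
Proof.
have [M M1 BM] :=
  continuous_linear_rnorm (@operator_shift_continuous _ _ _ _ p1 _ _ supT).
exists M => // n x; elim: n => [|n IH] /=; first by rewrite expr0 mul1r.
rewrite exprS -mulrA; apply: le_trans (BM _) _.
by rewrite ler_wpM2l// (le_trans _ M1).
Qed.

(** Makes the blocks at k + d, and those at k - d, disjoint for distinct d. *)
Lemma idx_succ_acyclic n m (k : idx J) : iter n succ k = iter m succ k -> n = m.
Proof.
case: J k => k /=.
  have E i : iter i (idx_succ (J := PositiveIntegers)) k = (k + i)%N.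
    by elim: i => [|i /= ->]; rewrite ?addn0 ?addnS.
  by rewrite !E => /addnI.
have E i : iter i (idx_succ (J := Integers)) k = k + i%:Z.
  elim: i => [|i /= ->]; first by rewrite addr0.
  by rewrite -addn1 PoszD addrA.
by rewrite !E => /addrI[].
Qed.

Lemma iter_succ_inj n : injective (iter n succ).
Proof. by elim: n => // n IH i j /idx_succ_inj/IH. Qed.

(** * Small preimages and small images from frequent hypercyclicity *)

Section frequently_hypercyclic.
Variable y : lp.
Hypothesis y_fhc : forall U : set lp, open U -> U !=set0 ->
  (0 < lower_density R [set n : nat | U (iter n B y)])%E.

Lemma return_times_differences_bounded z (r : R) (E : nat -> Prop) : 0 < r ->
  let A n := `[< rnorm (iter n B y - z) < r >] in
  (forall P, exists s Q, forall N (l : seq nat), uniq l ->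
    (forall d, d \in l -> exists e, [/\ E e, d <= e + s & e + s <= d + P]%N) ->
    (\sum_(d <- l) pair_count A N d <= Q * N.+1)%N) ->
  exists b, forall e, (b <= e)%N -> ~ E e.
Proof.
move=> r0 A Es.
have [q qA] : exists q, forall b, exists2 N, (b < N)%N &
    (N.+1 <= q * size (trunc A N))%N.
  apply: lower_density_gt0_trunc.
  apply: (y_fhc (U := [set x | rnorm (x - z) < r])).
    exact: rnorm_ball_open.
  by exists z => /=; rewrite subrr rnorm0.
apply: contrapT => nb; apply: (sparse_bounded Es qA) => b.
apply: contrapT => nE; apply: nb; exists b.+1 => e be Ee.
by apply: nE; exists e.
Qed.

Lemma shift_small_preimage k z (r e : R) : lp_mask [set k] z = z ->
  0 < r -> 0 < e -> exists n0, forall n, (n0 <= n)%N ->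
  exists u, rnorm u < e /\ rnorm (iter n B u - z) < r.
Proof.
move=> zk r0 e0.
have [M M1 BM] := rnorm_iter_shift; have M0 : 0 < M by exact: lt_le_trans M1.
have eM i j : (i <= j)%N -> e / M ^+ j <= e / M ^+ i by exact/ler_div_expr/M1/ltW.
have eM0 i : 0 <= e / M ^+ i by rewrite divr_ge0 ?exprn_ge0 ?ltW.
pose S d : set (idx J) := [set iter d succ k].
have tS : trivIset setT S.
  apply/trivIsetP => i j _ _ ij; apply/seteqP; split=> // h [/= ->].
  by move=> /idx_succ_acyclic ji; rewrite ji eqxx in ij.
have BS i d u : iter i B (lp_mask (S (d + i)%N) u) = lp_mask (S d) (iter i B u).
  rewrite iter_shift_mask; congr (lp_mask _ _); apply/seteqP; split=> j /=.
    by rewrite /S /= addnC iterD => /iter_succ_inj.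
  by rewrite /S /= => ->; rewrite -iterD addnC.
(* The failure of (a) at [d]. It propagates upwards: [iter i B] carries index k + d + i to k + d and
   multiplies norms by at most M^i. *)
pose bad (e : R) d := forall u,
  rnorm (lp_mask (S d) u) < e -> r <= rnorm (iter d B (lp_mask (S d) u) - z).
have badS d i (e' : R) : 0 < e' -> bad e' d -> bad (e' / M ^+ i) (d + i)%N.
  move=> e'0 de u ue; have := de (iter i B u).
  rewrite -BS iterD; apply; rewrite (le_lt_trans (BM _ _))//.
  by rewrite mulrC -ltr_pdivlMr// exprn_gt0.
have [||n0 n0P] := @return_times_differences_bounded z r (bad e).
- exact: r0.
(* The shift [P] turns the window around an exception f into [f, f + P], where (a) still fails for
   [e / M ^+ P]. *)
- move=> P; exists P.
  have [Q QP] := @exists_natr_mul_bound _ ((rnorm z + r) `^ p) ((e / M ^+ P) `^ p)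
    (powR_gt0 _ (divr_gt0 e0 (exprn_gt0 _ M0))).
  exists Q => N l ul lP; apply: sum_pair_count_le_fwd => m /asboolP mr.
  rewrite -size_filter; apply: QP.
  apply: (size_large_lp_mask (x := iter m B y) tS); first exact: filter_uniq.
  + exact: eM0.
  (* Were the coordinate k + d of B^m y small, its image under B^d would stay [r] away from [z]; but
     that image is the coordinate k of B^(m + d) y, which is closer than [r]. *)
  + move=> d; rewrite mem_filter => /andP[/asboolP mdr /lP[f [fbad df fd]]].
    rewrite leNgt; apply/negP => small.
    have := badS f (d - f)%N e e0 fbad (iter m B y).
    rewrite subnKC; last by lia.
    rewrite leNgt => /(_ _)/negP; apply.
      by apply: lt_le_trans small (eM _ _ _); lia.
    rewrite -[d]add0n BS -zk -lp_maskB.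
    by apply: le_lt_trans (rnorm_lp_mask _ _) _; rewrite -iterD addnC.
  + exact: rnorm_near_le.
exists n0 => n /n0P/existsNP[u /not_implyP[ue /negP]]; rewrite -ltNge => uz.
by exists (lp_mask (S n) u).
Qed.

Lemma shift_small_image k z (r e : R) : lp_mask [set k] z = z ->
  0 < r -> 0 < e -> exists n0, forall n, (n0 <= n)%N ->
  exists u, rnorm (u - z) < r /\ rnorm (iter n B u) < e.
Proof.
move=> zk r0 e0.
have [M M1 BM] := rnorm_iter_shift; have M0 : 0 < M by exact: lt_le_trans M1.
have eM i j : (i <= j)%N -> e / M ^+ j <= e / M ^+ i by exact/ler_div_expr/M1/ltW.
have eM0 i : 0 <= e / M ^+ i by rewrite divr_ge0 ?exprn_ge0 ?ltW.
(* The index k - d, or the empty set when the index set starts after it. *)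
pose S d : set (idx J) := [set j | iter d succ j = k].
have tS : trivIset setT S.
  apply/trivIsetP => i j _ _ ij; apply/seteqP; split=> // h [/= hi hj].
  by rewrite (idx_succ_acyclic (etrans hi (esym hj))) eqxx in ij.
have BS d u : iter d B (lp_mask [set k] u) = lp_mask (S d) (iter d B u).
  by rewrite iter_shift_mask.
pose bad (e : R) d := forall u,
  rnorm (lp_mask [set k] u - z) < r -> e <= rnorm (iter d B (lp_mask [set k] u)).
have badS d i (e' : R) : bad e' (d + i)%N -> bad (e' / M ^+ i) d.
  move=> de u /de; rewrite addnC iterD => /le_trans/(_ (BM _ _)).
  by rewrite ler_pdivrMr ?exprn_gt0// mulrC.
have [||n0 n0P] := @return_times_differences_bounded z r (bad e).
- exact: r0.
(* Here failure propagates downwards, so the window is [f - P, f]. *)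
- move=> P; exists 0%N.
  have [Q QP] := @exists_natr_mul_bound _ ((rnorm z + r) `^ p) ((e / M ^+ P) `^ p)
    (powR_gt0 _ (divr_gt0 e0 (exprn_gt0 _ M0))).
  exists Q => N l ul lP; apply: sum_pair_count_le_bwd => n /asboolP nr.
  rewrite -size_filter; apply: QP.
  apply: (size_large_lp_mask (x := iter n B y) tS); first exact: filter_uniq.
  + exact: eM0.
  + move=> d; rewrite mem_filter => /andP[/andP[dn /asboolP mdr] /lP[f [fbad df fd]]].
    have := badS d (f - d)%N e; rewrite subnKC; last by lia.
    move=> /(_ fbad (iter (n - d) B y)).
    rewrite BS -iterD subnKC// => large; apply: le_trans (large _).
      by apply: eM; lia.
    rewrite -zk -lp_maskB; exact: le_lt_trans (rnorm_lp_mask _ _) mdr.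
  + exact: rnorm_near_le.
exists n0 => n /n0P/existsNP[u /not_implyP[ue /negP]]; rewrite -ltNge => uz.
by exists (lp_mask [set k] u).
Qed.

(** Finitely supported vectors suffice by density, and (x, v) = (x, 0) + (0, v) separates case (b)
    from case (a), each settled coordinate by coordinate. *)
Lemma reaches_shift x v : reaches B x v.
Proof.
apply: reaches_closed => e e0.
have [F finF xF] := lp_mask_finite_approx x e0.
have [G finG vG] := lp_mask_finite_approx v e0.
exists (lp_mask F x), (lp_mask G v); split; [exact: xF|exact: vG|].
have xr : reaches B (lp_mask F x) 0.
  apply: (@lp_mask_finite_ind _ _ _ _ _ _ (fun x => reaches B x 0)) finF.
  - exact: reaches0.
  - by move=> y1 y2 r1 r2; have := reachesD r1 r2; rewrite addr0.
  - move=> k d d0; have [n0 n0P] := shift_small_image (lp_mask_id [set k] x) d0 d0.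
    by exists n0 => n /n0P[z]; exists z; rewrite subr0.
have vr : reaches B 0 (lp_mask G v).
  apply: (@lp_mask_finite_ind _ _ _ _ _ _ (reaches B 0)) finG.
  - exact: reaches0.
  - by move=> y1 y2 r1 r2; have := reachesD r1 r2; rewrite addr0.
  - move=> k d d0; have [n0 n0P] := shift_small_preimage (lp_mask_id [set k] v) d0 d0.
    by exists n0 => n /n0P[z]; exists z; rewrite subr0.
by have := reachesD xr vr; rewrite addr0 add0r.
Qed.

End frequently_hypercyclic.
End shift.

Theorem corollary3p14 (R : realType) (s : scalars) (J : index_set)
    (X : idx J -> completeNormedModType (scalar_field R s))
    (T : forall k : idx J, {linear X (idx_succ k) -> X k})
    (T_continuous : forall k : idx J, continuous (T k))
    (supT : (ereal_sup (range (fun k : idx J => opnorm (T k))) < +oo)%E)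
    (p : R) (p1 : 1 <= p) :
  frequently_hypercyclic R (operator_shift p1 supT : lp p1 X -> lp p1 X) ->
  mixing (operator_shift p1 supT : lp p1 X -> lp p1 X).
Proof.
by move=> [y y_fhc]; apply: reaches_mixing => x v; exact: reaches_shift y_fhc x v.
Qed.
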